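(* Let $\mathbf{K}^{Tor}$ be the class of torsion abelian groups with pure embeddings. For every infinite cardinal $\lambda$, $\mathbf{K}^{Tor}$ is $\lambda$-stable if and only if $\lambda^{\aleph_0}=\lambda$.
   Context: A subgroup $H$ of an abelian group $G$ is pure if $nH=nG\cap H$ for all $n\in\mathbb{N}$; $\mathbf{K}^{Tor}$ is the class of torsion abelian groups ordered by being a pure subgroup. Galois types: for $M\leq_p N_1,N_2$ in the class and $b_i\in N_i$, $(b_1,M,N_1)\sim(b_2,M,N_2)$ if there are $N$ in the class and pure embeddings $f_i:N_i\to N$ agreeing on $M$ with $f_1(b_1)=f_2(b_2)$ (an equivalence relation as the class has amalgamation); $\mathbf{gS}(M)$ is the set of equivalence classes with base $M$. $\mathbf{K}^{Tor}$ is $\lambda$-stable if $|\mathbf{gS}(M)|\leq\lambda$ for every $M\in\mathbf{K}^{Tor}$ of cardinality $\lambda$. *)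

(* Defs.v *)
From mathcomp Require Import all_boot all_algebra.
From mathcomp Require Import boolp classical_sets functions cardinality.

Set Implicit Arguments.
Unset Strict Implicit.
Unset Printing Implicit Defensive.

Import GRing.Theory.

Local Open Scope classical_set_scope.
Local Open Scope ring_scope.
Local Open Scope card_scope.

Definition subgroup (G : zmodType) (H : set G) : Prop :=
  H 0 /\ forall x y, H x -> H y -> H (x - y).

Definition multiples (G : zmodType) (n : nat) (H : set G) : set G :=
  [set x *+ n | x in H].

Definition pure_subgroup (G : zmodType) (H : set G) : Prop :=
  subgroup H /\ forall n : nat, multiples n H = multiples n [set: G] `&` H.

Definition pure_embedding (G1 G2 : zmodType) (f : {additive G1 -> G2}) : Prop :=
  injective f /\ pure_subgroup (range f).

Definition torsion (G : zmodType) : Prop :=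
  forall x : G, exists2 n : nat, (0 < n)%N & x *+ n = 0.

Record KTor := MkKTor {
  KTor_group :> zmodType;
  KTor_torsion : torsion KTor_group }.

(* A triple (b, M, N) with M <=_p N.  As types have no literal inclusion, the
   inclusion of M in N is a pure embedding, which identifies M with its image. *)
Record pretype (M : KTor) := Pretype {
  pretype_ext : KTor;
  pretype_incl : {additive M -> pretype_ext};
  pretype_pure : pure_embedding pretype_incl;
  pretype_elt : pretype_ext }.

Definition same_type (M : KTor) (p1 p2 : pretype M) : Prop :=
  exists (N : KTor)
         (f1 : {additive pretype_ext p1 -> N})
         (f2 : {additive pretype_ext p2 -> N}),
    [/\ pure_embedding f1,
        pure_embedding f2,
        forall m : M, f1 (pretype_incl p1 m) = f2 (pretype_incl p2 m) &
        f1 (pretype_elt p1) = f2 (pretype_elt p2)].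

(* The set of equivalence classes is a plain sigma type and its cardinality is
   compared by an injection, because pretype M, which quantifies over all groups,
   lives in a universe too large for the types set and card_le. *)
Definition gS (M : KTor) : Type :=
  {X : pretype M -> Prop | exists p : pretype M, X = same_type p}.

(* The cardinal lambda is represented by a type L of that cardinality. *)
Definition stable (L : Type) : Prop :=
  forall M : KTor, [set: M] #= [set: L] ->
    exists f : gS M -> L, injective f.

(* Main.v *)
(* (<=) Two pure extensions of M realise the same type at b1, b2 as soon as
   [n | m + k b] holds for the same m, k, n in both: the pushout of the two maps
   M x Z -> N_i is then pure over both N_i.  For fixed k, n the set of such m is
   empty or a coset of nM, hence coded by at most one element of M, so a type is
   coded by a countable sequence of elements of M.

   (=>) Let M be the direct sum over n in nat, a in L of cyclic groups of order
   2^(n+1) with generators e(n, a); it is pure in the torsion part N of the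
   corresponding direct product.  For eta : nat -> L the element
   b(eta) = sum_n 2^n e(n, eta n) of N has order 2, and its type over M
   determines eta, because 2^(n+1) divides the difference between b(eta) and the
   element sum_(k <= n) 2^k e(k, eta k) of M.  That |M| = |L| rests on the
   existence of an injection seq L -> L, obtained from Zorn's lemma. *)
From HB Require Import structures.
Require Import Defs.
From mathcomp Require Import all_boot all_algebra.
From mathcomp Require Import boolp classical_sets functions cardinality.

Set Implicit Arguments.
Unset Strict Implicit.
Unset Printing Implicit Defensive.

Import GRing.Theory Num.Theory.

Local Open Scope classical_set_scope.
Local Open Scope ring_scope.
Local Open Scope card_scope.

(** * Quotients, subgroups, purity and pushouts of abelian groups *)

Lemma additive_of (G H : zmodType) (f : G -> H) :
  {morph f : x y / x - y} -> exists F : {additive G -> H}, F =1 f.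
Proof.
move=> fB; pose F : {additive G -> H} :=
  HB.pack f (GRing.isZmodMorphism.Build G H f fB).
by exists F.
Qed.

Lemma subgroup_zmod_closed (G : zmodType) (S : set G) :
  subgroup S -> zmod_closed (fun x => x \in S).
Proof.
move=> [S0 SB]; split; rewrite /in_mem /=; first exact/mem_set.
by move=> x y /set_mem xS /set_mem yS; apply/mem_set/SB.
Qed.

Lemma quotient_exists (G : zmodType) (S : set G) : subgroup S ->
  exists (Q : zmodType) (pi : {additive G -> Q}),
    (forall q, exists x, pi x = q) /\ (forall x, pi x = 0 <-> S x).
Proof.
move=> /subgroup_zmod_closed SC.
pose I : zmodClosed G :=
  HB.pack (fun x : G => x \in S) (GRing.isZmodClosed.Build G _ SC).
exists (Quotient.quot I), (\pi_(Quotient.quot I))%qT.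
split=> [q|x]; first by exists (repr q); exact: reprK.
rewrite -(raddf0 (\pi_(Quotient.quot I))%qT).
split=> [/eqP|xS].
  by rewrite -Quotient.idealrBE subr0 => /set_mem.
by apply/eqP; rewrite -Quotient.idealrBE subr0; apply/mem_set.
Qed.

Lemma subgroup_exists (G : zmodType) (S : set G) : subgroup S ->
  exists (H : zmodType) (i : {additive H -> G}),
    injective i /\ forall x, S x <-> exists y, i y = x.
Proof.
move=> /subgroup_zmod_closed SC.
pose P : pred G := fun x => x \in S.
pose H : subZmodType P := HB.pack {x : G | P x}
  (GRing.SubChoice_isSubZmodule.Build G P {x : G | P x} SC).
exists H, (val : {additive H -> G}); split; first exact: val_inj.
move=> x; split=> [/mem_set xS|[y <-]].
  by exists (Sub x xS : H); exact: SubK.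
exact/set_mem/(valP y).
Qed.

(** Injectivity is absorbed by the case [n = 0], where divisibility by [n] means being zero. *)
Lemma pure_embeddingP (G H : zmodType) (f : {additive G -> H}) :
  pure_embedding f <->
  forall n x y, f x = y *+ n -> exists x', x = x' *+ n.
Proof.
split=> [[f_inj [_ f_pure]] n x y fxy|fP].
  have : multiples n (range f) (f x).
    by rewrite f_pure; split; [exists y | exists x].
  by move=> [_ [x' _ <-]]; rewrite -raddfMn => /f_inj <-; exists x'.
split.
  move=> x y fxy; apply/eqP; rewrite -subr_eq0.
  have [|z ->] := fP 0%N (x - y) 0; last by rewrite mulr0n.
  by rewrite raddfB fxy subrr mulr0n.
split.
  split; first by exists 0 => //; rewrite raddf0.
  by move=> _ _ [x _ <-] [y _ <-]; exists (x - y); rewrite // raddfB.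
move=> n; apply/seteqP; split=> [_ [_ [x _ <-] <-]|_ [[y _ <-] [x _ /[dup] e /fP]]].
  by split; [exists (f x) | exists (x *+ n); rewrite // raddfMn].
by move=> [x' xE]; exists (f x'); rewrite // -raddfMn -xE.
Qed.

(** The pushout is N1 x N2 modulo the elements [(g1 a, - g2 a)]. If the image of [x] in N1 becomes
    divisible by [n], then [x] is [g1 a] up to a multiple of [n], for some [a] with [g2 a] divisible
    by [n]; the hypothesis carries this divisibility back to [g1 a]. The group [A] may have elements
    of infinite order, which allows M x Z. *)
Lemma pushout_pure (A : zmodType) (N1 N2 : KTor)
    (g1 : {additive A -> N1}) (g2 : {additive A -> N2}) :
  (forall n a, (exists y, g1 a = y *+ n) <-> (exists y, g2 a = y *+ n)) ->
  exists (N : KTor) (f1 : {additive N1 -> N}) (f2 : {additive N2 -> N}),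
    [/\ pure_embedding f1, pure_embedding f2 & forall a, f1 (g1 a) = f2 (g2 a)].
Proof.
move=> g12.
pose S : set (N1 * N2)%type := [set (g1 a, - g2 a) | a in [set: A]].
have S_sub : subgroup S.
  split; first by exists 0; rewrite // !raddf0.
  move=> _ _ [a _ <-] [b _ <-]; exists (a - b) => //.
  by rewrite (raddfB g1) (raddfB g2) opprD.
have [Q [pi [pi_surj pi0]]] := quotient_exists S_sub.
have Q_tors : torsion Q.
  move=> q; have [[x1 x2] <-] := pi_surj q.
  have [n1 n1_gt0 x1n] := @KTor_torsion N1 x1.
  have [n2 n2_gt0 x2n] := @KTor_torsion N2 x2.
  exists (n1 * n2)%N; first by rewrite muln_gt0 n1_gt0.
  rewrite -raddfMn pairMnE /= mulrnA x1n mul0rn mulnC mulrnA x2n mul0rn.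
  exact: raddf0.
have [|f1 f1E] := @additive_of N1 Q (fun x => pi (x, 0)).
  by move=> x y; rewrite -raddfB; congr (pi (_, _)); rewrite subr0.
have [|f2 f2E] := @additive_of N2 Q (fun x => pi (0, x)).
  by move=> x y; rewrite -raddfB; congr (pi (_, _)); rewrite subr0.
have divE n u y : pi u = y *+ n ->
    exists a v, u = (v *+ n) + (g1 a, - g2 a).
  have [v <-] := pi_surj y; rewrite -raddfMn => /eqP.
  rewrite -subr_eq0 -raddfB => /eqP/pi0[a _ aE].
  by exists a, v; rewrite aE addrC subrK.
exists (MkKTor Q_tors), f1, f2; split.
- apply/pure_embeddingP => n x y; rewrite f1E => /divE[a [[v1 v2]]].
  rewrite pairMnE => -[-> /eqP]; rewrite eq_sym subr_eq0 => /eqP e.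
  have [|w ->] := (g12 n a).2; first by exists v2; rewrite e.
  by exists (v1 + w); rewrite mulrnDl.
- apply/pure_embeddingP => n x y; rewrite f2E => /divE[a [[v1 v2]]].
  rewrite pairMnE => -[/eqP]; rewrite eq_sym addr_eq0 => /eqP e ->.
  have [|w ->] := (g12 n a).1; first by exists (- v1); rewrite mulNrn e opprK.
  by exists (v2 - w); rewrite mulrnBl.
move=> a; rewrite f1E f2E; apply/eqP; rewrite -subr_eq0 -raddfB; apply/eqP/pi0.
by exists a => //; congr (_, _); rewrite ?subr0 ?sub0r.
Qed.

Lemma pure_embedding_id (G : zmodType) : pure_embedding (idfun : {additive G -> G}).
Proof. by apply/pure_embeddingP => n x y xE; exists y. Qed.

Lemma pure_embedding_comp (G H K : zmodType)
    (f : {additive G -> H}) (g : {additive H -> K}) :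
  pure_embedding f -> pure_embedding g -> pure_embedding (g \o f).
Proof.
move=> /pure_embeddingP fP /pure_embeddingP gP.
by apply/pure_embeddingP => n x y /gP[z /fP].
Qed.

(** * Galois types and the divisibility conditions that determine them *)

Section GaloisTypes.
Variable M : KTor.
Implicit Types p q r : pretype M.

Lemma same_type_refl p : same_type p p.
Proof.
by exists (pretype_ext p), idfun, idfun; split=> //; exact: pure_embedding_id.
Qed.

Lemma same_type_sym p q : same_type p q -> same_type q p.
Proof. by move=> [N [f [g [? ? fgM fgb]]]]; exists N, g, f; split. Qed.

(** Amalgamation over the middle extension: [f2] and [g1] are both pure, so divisibility of their
    values is divisibility in the common source, and the pushout is pure. *)
Lemma same_type_trans q p r : same_type p q -> same_type q r -> same_type p r.
Proof.
move=> [N [f1 [f2 [f1P f2P fM fb]]]] [N' [g1 [g2 [g1P g2P gM gb]]]].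
have [n a|K [h [k [hP kP hkE]]]] := @pushout_pure (pretype_ext q) N N' f2 g1.
  split=> -[y].
    by move/((pure_embeddingP _).1 f2P) => [z ->]; rewrite raddfMn; exists (g1 z).
  by move/((pure_embeddingP _).1 g1P) => [z ->]; rewrite raddfMn; exists (f2 z).
exists K, (h \o f1), (k \o g2); split; [exact: pure_embedding_comp..| |].
  by move=> m /=; rewrite fM hkE gM.
by rewrite /= fb hkE gb.
Qed.

Definition divides_at p (k : int) (n : nat) : set M :=
  [set m | exists y, pretype_incl p m + pretype_elt p *~ k = y *+ n].

Lemma same_type_divides_at p q :
  (forall k n, divides_at p k n = divides_at q k n) -> same_type p q.
Proof.
move=> pq.
pose g r (mk : M * int) := pretype_incl r mk.1 + pretype_elt r *~ mk.2.
have gB r : {morph g r : x y / x - y}.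
  by move=> [m k] [m' k']; rewrite /g /= raddfB mulrzBr opprD addrACA.
have [g1 g1E] := additive_of (gB p); have [g2 g2E] := additive_of (gB q).
have [n [m k]|N [f1 [f2 [f1P f2P fE]]]] := @pushout_pure _ _ _ g1 g2.
  rewrite g1E g2E -[exists y, _]/(divides_at p k n m) pq; exact: iff_refl.
(* The square commutes on M x Z: at [(m, 0)] this is agreement on M, at [(0, 1)] equality of the two
   images of the realised elements. *)
exists N, f1, f2; split=> // [m|].
  have := fE (m, 0); rewrite g1E g2E /g /= !mulr0z !addr0; exact.
by have := fE (0, 1); rewrite g1E g2E /g /= !raddf0 !mulr1z !add0r.
Qed.

(* By purity, [divides_at p k n] is empty or a coset of nM: one of its elements
   determines it. *)
Lemma divides_at_coset p k n m : divides_at p k n m ->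
  divides_at p k n = [set m' | exists z, m' = m + z *+ n].
Proof.
move=> [y yE]; apply/seteqP; split=> m' /=.
  move=> [y' y'E].
  have [|z zE] := (pure_embeddingP _).1 (pretype_pure p) n (m' - m) (y' - y).
    by rewrite mulrnBl -y'E -yE raddfB opprD addrACA subrr addr0.
  by exists z; rewrite -zE addrC subrK.
move=> [z ->]; exists (y + pretype_incl p z).
by rewrite mulrnDl -yE raddfD raddfMn addrAC.
Qed.

End GaloisTypes.

(** * Injections, choice and comparability of sets *)

Lemma card_leTP (T U : Type) :
  [set: T] #<= [set: U] <-> exists f : T -> U, injective f.
Proof.
split=> [/card_leP[f]|[f f_inj]].
  exists (fun x => val (f (SigSub (mem_setT x)))) => x y /val_inj fxy.
  have /(_ _ _ fxy) : injective f.
    by move=> u v; apply: (@inj _ _ setT f); rewrite inE.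
  by case.
have [g] : $|{injfun [set: T] >-> [set: U]}|.
  by apply/injfunPex; exists f => // x y _ _; exact: f_inj.
exact: inj_card_le g.
Qed.

Lemma set_injP (T U : Type) (A : set T) (f : T -> U) :
  set_inj A f <-> forall x y, A x -> A y -> f x = f y -> x = y.
Proof.
split=> f_inj x y; first by move=> /mem_set xA /mem_set yA; exact: f_inj.
by move=> /set_mem xA /set_mem yA; exact: f_inj.
Qed.

Lemma choice_on (T U : Type) (d : T -> U) (A : set T) (P : T -> U -> Prop) :
  (forall x, A x -> exists y, P x y) ->
  exists f : T -> U, forall x, A x -> P x (f x).
Proof.
move=> AP; suff /choice[f fP] : forall x, exists y, A x -> P x y by exists f.
move=> x; have [/AP[y Pxy]|Ax] := pselect (A x); first by exists y.
by exists (d x) => /Ax.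
Qed.

(** Zorn's lemma on graphs of partial injections from [A] to [B]. A maximal graph has full domain or
    full range, since otherwise a pair of missed points could be added; it is then read forwards or
    backwards. *)
Lemma set_inj_total (T : Type) (A B : set T) :
  (exists f : T -> T, set_fun A B f /\ set_inj A f) \/
  (exists f : T -> T, set_fun B A f /\ set_inj B f).
Proof.
pose P (G : set (T * T)) := [/\ G `<=` A `*` B,
  forall x y y', G (x, y) -> G (x, y') -> y = y' &
  forall x x' y, G (x, y) -> G (x', y) -> x = x'].
have [F FP Ftot|G [[GAB Gfun Ginj] Gmax]] := @Zorn_bigcup _ P.
  have FG u v X Y : F X -> F Y -> X u -> Y v -> exists2 Z, P Z & Z u /\ Z v.
    move=> FX FY Xu Yv; have [XY|YX] := Ftot X Y FX FY.
      by exists Y; [exact: FP | split=> //; exact: XY].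
    by exists X; [exact: FP | split=> //; exact: YX].
  split.
  - by move=> u [X /FP[XAB _ _] /XAB].
  - move=> x y y' [X FX Xu] [Y FY Yv].
    by have [Z [_ Zfun _] [Zu Zv]] := FG _ _ _ _ FX FY Xu Yv; exact: Zfun Zu Zv.
  - move=> x x' y [X FX Xu] [Y FY Yv].
    by have [Z [_ _ Zinj] [Zu Zv]] := FG _ _ _ _ FX FY Xu Yv; exact: Zinj Zu Zv.
have [/(choice_on id)[f fG]|/existsNP[a]] :=
    pselect (forall x, A x -> exists y, G (x, y)).
  left; exists f; split=> [x /fG/GAB[]//|x y /set_mem/fG Gx /set_mem/fG Gy e].
  by apply: Ginj Gx _; rewrite e.
move=> /not_implyP[Aa Ga].
have [/(choice_on id)[f fG]|/existsNP[b]] :=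
    pselect (forall y, B y -> exists x, G (x, y)).
  right; exists f; split=> [x /fG/GAB[]//|x y /set_mem/fG Gx /set_mem/fG Gy e].
  by apply: Gfun Gx _; rewrite e.
move=> /not_implyP[Bb Gb]; exfalso.
apply: (Gmax (G `|` [set (a, b)])).
  split=> [u|]; first by left.
  by move=> /(_ (a, b)) Gab; apply: Ga; exists b; apply: Gab; right.
split.
- by move=> u [/GAB//|->].
- move=> x y y' [Gxy|[xa yb]] [Gxy'|[xa' yb']]; first exact: Gfun Gxy Gxy'.
  + by case: Ga; exists y; rewrite -xa'.
  + by case: Ga; exists y'; rewrite -xa.
  + by rewrite yb yb'.
- move=> x x' y [Gxy|[xa yb]] [Gxy'|[xa' yb']]; first exact: Ginj Gxy Gxy'.
  + by case: Gb; exists x; rewrite -yb'.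
  + by case: Gb; exists x'; rewrite -yb.
  + by rewrite xa xa'.
Qed.

(** * Finite sequences over an infinite type *)

Section SeqInjection.
Variable T : Type.
Implicit Types (A : set T) (f : seq T -> T) (s : seq T).

Definition seqs_in A : set (seq T) := [set s | all [in A] s].

Definition seq_coding A f : Prop :=
  set_fun (seqs_in A) A f /\ set_inj (seqs_in A) f.

Lemma seqs_in_sub A A' : A `<=` A' -> seqs_in A `<=` seqs_in A'.
Proof. by move=> AA' s; apply: sub_all => x /set_mem/AA'/mem_set. Qed.

Lemma seqs_in_map A A' (h : T -> T) s :
  set_fun A A' h -> seqs_in A s -> seqs_in A' (map h s).
Proof.
rewrite /seqs_in /= all_map => hA; apply: sub_all => x /set_mem/hA.
exact: mem_set.
Qed.

Lemma seqs_in_map_inj A (h : T -> T) : set_inj A h -> set_inj (seqs_in A) (map h).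
Proof.
move=> h_inj s s' /set_mem sA /set_mem s'A.
elim: s s' sA s'A => [|x s IH] [|x' s'] //= /andP[xA sA] /andP[x'A s'A].
by case=> /h_inj -> // /IH ->.
Qed.

(* A coding on A absorbs any second copy of A: [x] codes x in A, and [k x, k x]
   codes x outside A. *)
Lemma seq_coding_double A f X (k : T -> T) : seq_coding A f ->
  set_fun (X `\` A) A k -> set_inj (X `\` A) k ->
  exists h : T -> T, set_fun X A h /\ set_inj X h.
Proof.
move=> [fA /set_injP f_inj] kA /set_injP k_inj.
pose r x := if x \in A then [:: x] else [:: k x; k x].
have rA x : X x -> seqs_in A (r x).
  rewrite /r /seqs_in /= => Xx; case: ifPn => [xA|/negP xA] /=; first by rewrite xA.
  by rewrite (mem_set (kA x _)) //; split=> // Ax; apply/xA/mem_set.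
exists (f \o r); split=> [x /rA/fA//|]; apply/set_injP => x y Xx Xy.
move=> /(f_inj _ _ (rA _ Xx) (rA _ Xy)); rewrite /r.
case: ifPn => [xA|/negP xA]; case: ifPn => [yA|/negP yA] // [] // kxy _.
by apply: k_inj kxy; split=> // /mem_set.
Qed.

(** A maximal coded set [A] is compared with its complement. If the complement embeds in [A], so
    does the whole type, and its sequences are coded in [A]; if [A] embeds in its complement, the
    coding extends to a strictly larger set. *)
Lemma seq_inj_exists :
  infinite_set [set: T] -> exists f : seq T -> T, injective f.
Proof.
move=> /infiniteP/card_leTP[j j_inj].
pose C := {Af : set T * (seq T -> T) | seq_coding Af.1 Af.2}.
pose car (t : C) := (sval t).1; pose cod (t : C) := (sval t).2.
have codP t : seq_coding (car t) (cod t) := svalP t.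
(* Only a preorder: a coding takes arbitrary values on sequences that leave its carrier. *)
pose R (t u : C) :=
  `[< car t `<=` car u /\ forall s, seqs_in (car t) s -> cod t s = cod u s >].
have [t0 _] : exists t : C, True.
  (* The starting point is a countable carrier, the range of [j], where sequences of naturals are
     coded by [pickle]. *)
  have [x [n _ nx]|jinv jinvK] :=
    @choice_on T nat (fun=> 0%N) (range j) (fun x n => j n = x); first by exists n.
  have jK s : seqs_in (range j) s -> map j (map jinv s) = s.
    by elim: s => //= x s IH /andP[/set_mem/jinvK -> /IH ->].
  have jP : seq_coding (range j) (fun s => j (pickle (map jinv s))).
    split=> [s _|]; first by exists (pickle (map jinv s)).
    apply/set_injP => s s' /jK sj /jK s'j.
    by move=> /j_inj/(pcan_inj pickleK) e; rewrite -sj e s'j.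
  by exists (exist _ (range j, fun s => j (pickle (map jinv s))) jP).
have Rxx t : R t t by apply/asboolP; split.
have Rtr : forall t u v, R t u -> R u v -> R t v.
  move=> t u v /asboolP[tu tuE] /asboolP[uv uvE]; apply/asboolP; split.
    exact: subset_trans tu uv.
  by move=> s ts; rewrite tuE // uvE //; exact: seqs_in_sub ts.
have [D Dtot|[[A f] /= fP] tmax] := ZL_preorder t0 Rxx Rtr.
  have [[d Dd]|D0] := pselect (exists t, D t); last first.
    by exists t0 => s Ds; case: D0; exists s.
  pose A := \bigcup_(t in D) car t.
  (* A sequence is finite, so along a chain all its entries already lie in one carrier. *)
  have AP s : seqs_in A s -> exists t, D t /\ seqs_in (car t) s.
    elim: s => [|x s IH] /=; first by exists d.
    move=> /andP[/set_mem[t Dt tx] /IH[u [Du us]]].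
    have [/asboolP[tu _]|/asboolP[ut _]] := Dtot t u Dt Du.
      by exists u; split=> //=; apply/andP; split=> //; apply/mem_set/tu.
    exists t; split=> //=; apply/andP; split; first exact/mem_set.
    exact: seqs_in_sub us.
  have [u uP] := choice_on (fun=> d) AP; pose f s := cod (u s) s.
  have fE t s : D t -> seqs_in (car t) s -> f s = cod t s.
    move=> Dt ts; have [|Du us] := uP s.
      by apply: seqs_in_sub ts => x tx; exists t.
    rewrite /f.
    by have [/asboolP[_ ->]|/asboolP[_ ->]] := Dtot _ _ Dt Du.
  have fP : seq_coding A f.
    split=> [s /AP[t [Dt ts]]|s s' /set_mem/AP[t [Dt ts]] /set_mem/AP[v [Dv vs']]].
      by rewrite (fE t) //; exists t => //; apply: (codP t).1.
    have [/asboolP[tv _]|/asboolP[vt _]] := Dtot t v Dt Dv.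
      have vs := seqs_in_sub tv ts.
      by rewrite !(fE v) //; apply: (codP v).2; rewrite inE.
    have ts' := seqs_in_sub vt vs'.
    by rewrite !(fE t) //; apply: (codP t).2; rewrite inE.
  exists (exist _ (A, f) fP) => t Dt; apply/asboolP; split=> [x tx|s ts].
    by exists t.
  by rewrite /cod /= (fE t).
have [fA /set_injP f_inj] := fP.
have [[g [gA g_inj]]|[g [gA g_inj]]] := set_inj_total A (~` A); last first.
  have [||h [hA h_inj]] := @seq_coding_double A f setT g fP.
  - by move=> x [_]; exact: gA.
  - by move=> x y /set_mem[_ Ax] /set_mem[_ Ay]; apply: g_inj; rewrite inE.
  have sT s : seqs_in setT s.
    by elim: s => // x s IH; apply/andP; split=> //; exact/mem_set.
  have hs s : seqs_in A (map h s) by exact: seqs_in_map hA (sT s).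
  exists (f \o map h) => s s' /(f_inj _ _ (hs s) (hs s')).
  by move/set_injP: (seqs_in_map_inj h_inj); apply; exact: sT.
exfalso; pose X := A `|` g @` A.
have [x [[//|[a Aa ax]] _]|k kP] := @choice_on T T id (X `\` A)
    (fun x a => A a /\ g a = x).
  by exists a.
have [||h [hA h_inj]] := @seq_coding_double A f X k fP.
- by move=> x /kP[].
- by move=> x y /set_mem/kP[_ {2}<-] /set_mem/kP[_ {2}<-] ->.
(* New sequences are pulled into [A] by [h], coded there, and moved by [g] into the complement, away
   from all old codes. *)
pose f' s := if s \in seqs_in A then f s else g (f (map h s)).
have f'P : seq_coding X f'.
  split=> [s Xs|s s' /set_mem Xs /set_mem Xs'].
    rewrite /f'; case: ifPn => [/set_mem/fA|_]; first by left.
    by right; exists (f (map h s)) => //; apply/fA/(seqs_in_map hA).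
  have fh u : seqs_in X u -> A (f (map h u)).
    by move=> Xu; apply/fA/(seqs_in_map hA).
  rewrite /f'; case: ifPn => [sA|sA]; case: ifPn => [s'A|s'A].
  - by apply: f_inj; exact: set_mem.
  - by move=> e; case: (gA _ (fh _ Xs')); rewrite -e; apply/fA/set_mem.
  - by move=> e; case: (gA _ (fh _ Xs)); rewrite e; apply/fA/set_mem.
  - move=> /((set_injP _ _).1 g_inj _ _ (fh _ Xs) (fh _ Xs')).
    move=> /(f_inj _ _ (seqs_in_map hA Xs) (seqs_in_map hA Xs')).
    by move/set_injP: (seqs_in_map_inj h_inj); apply.
have /asboolP[XA _] : R (exist _ (X, f') f'P) (exist _ (A, f) fP).
  apply: tmax; apply/asboolP; split=> [x|s As]; first by left.
  by rewrite /cod /= /f' mem_set.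
(* The code of the empty sequence shows that [A] is nonempty, so its image under [g] is a point of
   [X] outside [A]. *)
have Af0 : A (f [::]) by exact: fA.
by apply: (gA _ Af0); apply: XA; right; exists (f [::]).
Qed.

End SeqInjection.

(** * A direct sum of cyclic 2-groups inside the torsion part of the product *)

Section Unstable.
Variable L : choiceType.
Let I : choiceType := (nat * L)%type.

(** The kernel of reduction from integer families to the product of the cyclic groups of order
    2^(n+1), one for each [(n, a)]; elements of the product are thus handled through integer
    lifts. *)
Definition null_family : set (I -> int) :=
  [set f | forall i, exists z, f i = z *+ 2 ^ i.1.+1].

Lemma null_family_subgroup : subgroup null_family.
Proof.
split=> [i|f g fS gS i]; first by exists 0; rewrite mul0rn.
have [[z zE] [w wE]] := (fS i, gS i).
by exists (z - w); rewrite mulrnBl -zE -wE.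
Qed.

Definition finite_support (f : I -> int) : Prop :=
  exists s : seq I, forall i, i \notin s -> f i = 0.

Lemma fctMnE (f : I -> int) n i : (f *+ n) i = f i *+ n.
Proof. by elim: n => // n IH; rewrite !mulrS -IH. Qed.

Lemma fctBE (f g : I -> int) i : (f - g) i = f i - g i.
Proof. by []. Qed.

Definition spike (eta : nat -> L) : I -> int :=
  fun i => if i.2 == eta i.1 then 1 *+ 2 ^ i.1 else 0.

Definition spike_trunc (eta : nat -> L) (n : nat) : I -> int :=
  fun i => if (i.1 <= n)%N then spike eta i else 0.

Lemma spike_trunc_finite eta n : finite_support (spike_trunc eta n).
Proof.
exists [seq (k, eta k) | k <- iota 0 n.+1] => -[k a] /negP kaP.
rewrite /spike_trunc /spike /=; case: ifP => // kn; case: eqP => // aE.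
by case: kaP; apply/mapP; exists k; rewrite ?aE // mem_iota ltnS.
Qed.

Lemma spike_null eta : null_family (spike eta *+ 2).
Proof.
move=> i; rewrite fctMnE /spike; case: eqP => _; last by exists 0; rewrite !mul0rn.
by exists 1; rewrite -mulrnA expnSr.
Qed.

(** The truncation keeps index [n] itself, so each surviving coordinate is 0 or 2^k with k > n. *)
Lemma spike_trunc_divides eta n :
  exists g, spike eta - spike_trunc eta n = g *+ 2 ^ n.+1.
Proof.
exists (fun i => if (i.1 <= n)%N then 0 else
  if i.2 == eta i.1 then 1 *+ 2 ^ (i.1 - n.+1) else 0).
apply/funext => i; rewrite fctMnE fctBE /spike_trunc; case: leqP => [_|ni]; first by rewrite subrr mul0rn.
rewrite subr0 /spike; case: eqP => _; last by rewrite mul0rn.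
by rewrite -mulrnA -expnD subnK.
Qed.

(* The (n, eta n) coordinate of [spike eta] has order exactly 2 modulo 2^(n+1). *)
Lemma spike_trunc_inj eta nu n g :
  null_family (spike_trunc eta n - spike_trunc nu n - g *+ 2 ^ n.+1) ->
  eta n = nu n.
Proof.
move=> /(_ (n, eta n))[z]; rewrite !fctBE fctMnE /spike_trunc /spike /= leqnn eqxx; case: eqP => // _.
rewrite subr0 => /eqP; rewrite subr_eq -mulrnDl expnS mulrnA.
rewrite eqrMn2r expn_eq0 /= => /eqP/(congr1 (fun u => odd `|u|)).
by rewrite -mulr_natr abszM oddM andbF.
Qed.

Lemma finite_support_subgroup : subgroup finite_support.
Proof.
split=> [|f g [s sP] [t tP]]; first by exists [::].
exists (s ++ t) => i; rewrite mem_cat negb_or => /andP[/sP fi /tP gi].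
by rewrite fctBE fi gi subrr.
Qed.

Lemma finite_support_torsion f :
  finite_support f -> exists2 n, (0 < n)%N & null_family (f *+ n).
Proof.
move=> [s sP]; exists (2 ^ \max_(i <- s) i.1.+1)%N; first by rewrite expn_gt0.
move=> i; rewrite fctMnE; have [is_|/sP ->] := boolP (i \in s); last first.
  by exists 0; rewrite !mul0rn.
exists (f i *+ 2 ^ (\max_(i <- s) i.1.+1 - i.1.+1)).
by rewrite -mulrnA -expnD subnK //; exact: leq_bigmax_seq.
Qed.

(** Divisibility is coordinatewise, so [g] can be cut down to the support of [f]. *)
Lemma finite_support_pure f g n : finite_support f -> null_family (f - g *+ n) ->
  exists2 h, finite_support h & null_family (f - h *+ n).
Proof.
move=> [s sP] fg; exists (fun i => if i \in s then g i else 0).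
  by exists s => i /negbTE ->.
move=> i; rewrite fctBE fctMnE; case: ifPn => [_|/sP ->]; last by exists 0; rewrite !mul0rn subr0.
by have [z zE] := fg i; exists z; rewrite -zE -fctMnE.
Qed.

(** A family is recovered from the finite list of its graph points over a chosen list containing its
    support; [c] codes first each point and then the list. *)
Lemma finite_support_coding (c : seq L -> L) (j : nat -> L) :
  injective c -> injective j ->
  exists code : (I -> int) -> L, forall f g, finite_support f ->
    finite_support g -> code f = code g -> f = g.
Proof.
move=> c_inj j_inj.
pose e (u : I * int) := c [:: j u.1.1; u.1.2; j (pickle u.2)].
have e_inj : injective e.
  move=> [[n a] k] [[n' a'] k'] /c_inj[/j_inj -> ->].
  by move=> /j_inj/(pcan_inj pickleK) ->.
have [s sP] := @choice_on _ _ (fun=> [::]) finite_support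
  (fun f s => forall i, i \notin s -> f i = 0) (fun f h => h).
exists (fun f => c [seq e (i, f i) | i <- s f]).
move=> f g /sP fP /sP gP /c_inj fg; apply/funext => i.
have in_both h h' : [seq e (k, h k) | k <- s h] = [seq e (k, h' k) | k <- s h'] ->
    i \in s h -> h i = h' i.
  move=> hh' /(map_f (fun k => e (k, h k))); rewrite hh'.
  by move=> /mapP[k _ /e_inj[-> ->]].
have [ifs|/[dup] /fP -> ifs] := boolP (i \in s f); first exact: in_both.
have [igs|/gP -> //] := boolP (i \in s g).
by rewrite (in_both g f) // fP.
Qed.

Lemma unstable_pair (c : seq L -> L) (j : nat -> L) :
  injective c -> injective j ->
  exists (M N : KTor) (i : {additive M -> N}) (b : (nat -> L) -> N)
         (m : (nat -> L) -> nat -> M),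
    [/\ pure_embedding i, [set: M] #= [set: L],
        forall eta n, exists y, b eta - i (m eta n) = y *+ 2 ^ n.+1 &
        forall eta nu n y, i (m eta n - m nu n) = y *+ 2 ^ n.+1 -> eta n = nu n].
Proof.
move=> c_inj j_inj.
have [Q [pi [pi_surj pi0]]] := quotient_exists null_family_subgroup.
have piE f g : pi f = pi g <-> null_family (f - g).
  rewrite -pi0 raddfB; split=> [->|/eqP]; first by rewrite subrr.
  by rewrite subr_eq0 => /eqP.
(* [Q] is the full product; its torsion subgroup [T] becomes N, and the direct sum [F] becomes M. *)
pose T : set Q := [set q | exists2 n, (0 < n)%N & q *+ n = 0].
have T_sub : subgroup T.
  split=> [|x y [n n0 xn] [k k0 yk]]; first by exists 1%N.
  exists (n * k)%N; first by rewrite muln_gt0 n0.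
  by rewrite mulrnBl mulrnA xn mul0rn mulnC mulrnA yk mul0rn subrr.
pose F : set Q := pi @` finite_support.
have F_sub : subgroup F.
  have [F0 FB] := finite_support_subgroup.
  split; first by exists 0; rewrite ?raddf0.
  by move=> _ _ [f ff <-] [g gf <-]; exists (f - g); [exact: FB|rewrite raddfB].
have FT : F `<=` T.
  move=> _ [f /finite_support_torsion[n n0 fn] <-]; exists n => //.
  by rewrite -raddfMn; apply/pi0.
have [N0 [iN [iN_inj iNP]]] := subgroup_exists T_sub.
have [M0 [iM [iM_inj iMP]]] := subgroup_exists F_sub.
have N_tors : torsion N0.
  move=> x; have [n n0 xn] := (iNP (iN x)).2 (ex_intro _ x erefl).
  by exists n => //; apply: iN_inj; rewrite raddfMn xn raddf0.
have M_tors : torsion M0.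
  move=> x; have /FT[n n0 xn] := (iMP (iM x)).2 (ex_intro _ x erefl).
  by exists n => //; apply: iM_inj; rewrite raddfMn xn raddf0.
pose M := MkKTor M_tors; pose N := MkKTor N_tors.
have /choice[incl inclE] : forall x : M, exists y : N, iN y = iM x.
  by move=> x; apply/iNP/FT/iMP; exists x.
have [x y|i iE] := @additive_of M N incl.
  by apply: iN_inj; rewrite raddfB !inclE raddfB.
have iME f : finite_support f -> exists x : M, iM x = pi f.
  by move=> ff; apply/iMP; exists f.
have /choice[b bE] : forall eta, exists y : N, iN y = pi (spike eta).
  move=> eta; apply/iNP; exists 2 => //.
  by rewrite -raddfMn; apply/pi0; exact: spike_null.
have /choice[m mE] : forall eta, exists m : nat -> M,
    forall n, iM (m n) = pi (spike_trunc eta n).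
  move=> eta; suff /choice[m mE] : forall n, exists x : M,
    iM x = pi (spike_trunc eta n) by exists m.
  by move=> n; apply/iME/spike_trunc_finite.
have m_inj eta nu n y : i (m eta n - m nu n) = y *+ 2 ^ n.+1 -> eta n = nu n.
  move=> /(congr1 iN); rewrite iE inclE raddfB !mE raddfMn -raddfB.
  have [g <-] := pi_surj (iN y); rewrite -raddfMn => /piE.
  exact: spike_trunc_inj.
exists M, N, i, b, m; split=> //.
- apply/pure_embeddingP => n x y ixy.
  have [f ff fx] := (iMP (iM x)).2 (ex_intro _ x erefl).
  have [g gy] := pi_surj (iN y).
  have /piE : pi f = pi (g *+ n) by rewrite raddfMn gy -raddfMn -ixy iE inclE fx.
  move=> /(finite_support_pure ff)[h hf /piE fh].
  have [z zE] := iME h hf; exists z.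
  by apply: iM_inj; rewrite raddfMn zE -raddfMn -fh.
- apply: Cantor_Bernstein; apply/card_leTP.
    have [code codeP] := finite_support_coding c_inj j_inj.
    have /choice[r rP] : forall x : M, exists f, finite_support f /\ pi f = iM x.
      move=> x; have [f ff fx] := (iMP (iM x)).2 (ex_intro _ x erefl).
      by exists f.
    exists (code \o r) => x y /codeP rxy; apply: iM_inj.
    by rewrite -(rP x).2 -(rP y).2 rxy //; [exact: (rP x).1 | exact: (rP y).1].
  (* Truncating at 0 the spike of a constant sequence leaves the generator e(0, a). *)
  exists (fun a => m (fun=> a) 0%N) => a a' maa'.
  apply: (m_inj (fun=> a) (fun=> a') 0%N 0).
  by rewrite maa' subrr raddf0 mul0rn.
move=> eta n; have [g gE] := spike_trunc_divides eta n.
(* The quotient [g] was found in the full product; it is torsion because its multiple by 2^(n+1)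
   is. *)
have [y yE] : exists y : N, iN y = pi g.
  apply/iNP.
  have [k k0 kE] : T (pi g *+ 2 ^ n.+1).
    rewrite -raddfMn -gE raddfB -mE -bE -inclE -raddfB.
    by apply/iNP; exists (b eta - incl (m eta n)).
  by exists (2 ^ n.+1 * k)%N; rewrite ?muln_gt0 ?expn_gt0 // mulrnA.
exists y; apply: iN_inj.
by rewrite raddfB iE inclE bE mE raddfMn yE -raddfB gE raddfMn.
Qed.

End Unstable.

(** * The two implications *)

Lemma stable_power (L : Type) :
  infinite_set [set: L] -> stable L -> [set: nat -> L] #<= [set: L].
Proof.
move=> L_inf; have [c c_inj] := seq_inj_exists L_inf.
have /infiniteP/card_leTP[j j_inj] := L_inf.
have [M [N [i [b [m [i_pure ML bm m_inj]]]]]] :=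
  @unstable_pair {classic L} c j c_inj j_inj.
move=> /(_ M ML)[f f_inj]; apply/card_leTP.
pose p eta : pretype M := Pretype i_pure (b eta).
pose X eta : gS M := exist _ (same_type (p eta)) (ex_intro _ (p eta) erefl).
exists (f \o X) => eta nu /f_inj/(congr1 sval) /= e.
have [K [f1 [f2 [/pure_embeddingP f1P _ fi fb]]]] : same_type (p eta) (p nu).
  by rewrite e; exact: same_type_refl.
apply/funext => n; have [y yE] := bm eta n; have [z zE] := bm nu n.
rewrite /= in fi fb.
(* In [K] the images of [b eta] and [b nu] coincide, so subtracting the two divisibility relations
   shows 2^(n+1) dividing the image of the difference of the truncations; purity of [f1] brings this
   back to N. *)
have [|w /m_inj //] := f1P (2 ^ n.+1)%N (i (m eta n - m nu n)) (f2 z - f1 y).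
rewrite mulrnBl -!raddfMn -yE -zE (raddfB i) (raddfB f1) (raddfB f2) (raddfB f1) -fb -fi.
by rewrite opprB [RHS]addrC subrKA.
Qed.

Lemma power_stable (L : Type) :
  infinite_set [set: L] -> [set: nat -> L] #<= [set: L] -> stable L.
Proof.
move=> /infiniteP/card_leTP[j j_inj] /card_leTP[e e_inj] M /card_eqPle[].
move=> /card_leTP[h h_inj] _.
have j01 : j 0%N <> j 1%N by move/j_inj.
have /choice[rep repE] (X : gS M) : exists p, sval X = same_type p by case: X.
have [pk [upk pkK]] : exists (pk : int * nat * bool -> nat) upk, pcancel pk upk.
  by exists pickle, unpickle; exact: pickleK.
(* The flag [d] separates two data: whether the coset is empty, told by [j 0] against [j 1], and a
   chosen element of it, with default 0 when it is empty. *)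
pose code p (t : int * nat * bool) : L := let: (k, n, d) := t in
  if d then (if `[< divides_at p k n !=set0 >] then j 0%N else j 1%N)
  else h (xget 0 (divides_at p k n)).
have codeP p q : code p = code q -> same_type p q.
  move=> pq; apply: same_type_divides_at => k n.
  have := congr1 (@^~ (k, n, true)) pq; have := congr1 (@^~ (k, n, false)) pq.
  rewrite /code => /h_inj xpq.
  case: asboolP => [[m mp]|p0]; case: asboolP => [[m' mq]|q0] //; try by [].
  - move=> _; have Dp := xgetPex 0 (ex_intro _ m mp).
    have Dq := xgetPex 0 (ex_intro _ m' mq).
    by rewrite (divides_at_coset Dp) (divides_at_coset Dq) xpq.
  - by move=> /esym.
  move=> _; apply/seteqP; split=> x xD; [case: p0 | case: q0]; by exists x.
(* Triples are countable, so a code becomes a sequence indexed by naturals, filled with [j 0] where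
   [upk] is undefined. *)
exists (fun X => e (fun n => if upk n is Some t then code (rep X) t else j 0%N)).
move=> X Y /e_inj XY.
have /codeP XYs : code (rep X) = code (rep Y).
  by apply/funext => t; have := congr1 (@^~ (pk t)) XY; rewrite /= pkK.
have : sval X = sval Y.
  rewrite !repE; apply/funext => r; apply/propext.
  by split; apply: same_type_trans => //; exact: same_type_sym.
by case: X Y {XY XYs} => [X ?] [Y ?] /= XY; exact: eq_exist.
Qed.

Theorem theorem5p6 (L : Type) (L_infinite : infinite_set [set: L]) :
  stable L <-> [set: nat -> L] #= [set: L].
Proof.
split=> [Lst|/card_eqPle[+ _]]; last exact: power_stable.
apply: Cantor_Bernstein; first exact: stable_power.
by apply/card_leTP; exists (fun a _ => a) => a b /(congr1 (@^~ 0%N)).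
Qed.
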